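(* Every frame is (isomorphic to) a subdirect $(\mathfrak{E},\mathfrak{M})$-product of its pointless and spatial parts. In detail, for any frame $L$ the product morphism $\pi_L\times\sigma_L : L\to \pi L\times\sigma L$, $b\mapsto(\pi_L(b),\sigma_L(b))$, factors through the inclusion $\pi L\times_{\lambda_L}\sigma L\to \pi L\times\sigma L$, and the initial factor $\tau_L : L\to \pi L\times_{\lambda_L}\sigma L$ of this factorization is one-one.
   Context: All frames are completely regular (the one-element frame $\{\bot=\top\}$ is allowed); frame homomorphisms preserve finite meets and arbitrary joins. $\max L$ is the set of maximal elements of $L\setminus\{\top\}$. An element $c$ is a successor of $a$ if $c>a$ and there is no $b$ with $a<b<c$. Pointless part: $\pi L=\{a\in L: a \text{ has no successor}\}$ is a sublocale of $L$, with quotient map (nucleus) $\pi_L:L\to\pi L$, $\pi_L(b)=\bigwedge\{a\in\pi L: a\ge b\}$. A frame is pointless if it has no maximal elements. Spatial part: $\sigma L=\{b\in L: b=\bigwedge\{a\in\max L: a\ge b\}\}$ is a sublocale of $L$, with quotient map $\sigma_L:L\to\sigma L$, $\sigma_L(b)=\bigwedge\{a\in\max L:a\ge b\}$. A frame homomorphism $m:L\to M$ is skinny if $\pi_M(m(a))=\top$ for all $a\in\max L$. $\mathbf{Fs}$ is the category of frames and skinny homomorphisms. For $a\in L$ put $\Phi_a=\{(a_1,a_2): a\wedge a_1=a\wedge a_2\}$, and for a surjection $e$ put $\Theta_e=\{(a_1,a_2): e(a_1)=e(a_2)\}$. $\mathfrak{E}$ is the class of frame surjections $e:L\to M$ such that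 $\Theta_e=\bigvee\{\Phi_a: a\in\max L,\ e(a)=\top\}$ (join in the frame of congruences of $L$). $\mathfrak{M}$ is the class of sources $(m_i:L\to M_i)_I$ in $\mathbf{Fs}$ such that for every $a\in\max L$ there is $i\in I$ with $m_i(a)<\top$; a single morphism $m:L\to M$ is in $\mathfrak{M}$ if $m(a)<\top$ for all $a\in\max L$. A subdirect $(\mathfrak{E},\mathfrak{M})$-product of frames $E$ and $M$ is a subframe $K$ of $E\times M$ such that the projection $K\to E$ is a surjection in $\mathfrak{E}$ and the projection $K\to M$ is a surjection in $\mathfrak{M}$. The ligature $\lambda_L:\pi L\to\pi\sigma L$ is the unique frame homomorphism with $\lambda_L\circ\pi_L=\pi_{\sigma L}\circ\sigma_L$. The frame $\pi L\times_{\lambda_L}\sigma L$ is the largest completely regular subframe of $\{(a,b)\in\pi L\times\sigma L:\lambda_L(a)=\pi_{\sigma L}(b)\}$. *)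

(* Defs.v *)
From HB Require Import structures.
From mathcomp Require Import all_boot all_order all_algebra.
From mathcomp Require Import boolp classical_sets.

Set Implicit Arguments.
Unset Strict Implicit.
Unset Printing Implicit Defensive.

Import Order.Theory GRing.Theory Num.Theory.
Local Open Scope classical_set_scope.
Local Open Scope order_scope.

(* Complete regularity is a separate predicate, [completely_regular], and not
   part of the frame structure. Nothing requires \bot != \top. *)
HB.mixin Record isFrame d T of Order.TBDistrLattice d T := {
  fjoin : set T -> T;
  fjoin_lub : forall (A : set T) (x : T), fjoin A <= x <-> ubound A x;
  meet_fjoin : forall (a : T) (A : set T),
    a `&` fjoin A = fjoin [set a `&` b | b in A]
}.

#[short(type="frameType")]
HB.structure Definition Frame d := {T of isFrame d T & Order.TBDistrLattice d T}.

HB.factory Record POrder_isFrame d T of Order.POrder d T := {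
  top : T;
  meet : T -> T -> T;
  join : set T -> T;
  lex1 : forall x : T, x <= top;
  lexI : forall x y z : T, (x <= meet y z) = (x <= y) && (x <= z);
  join_lub : forall (A : set T) (x : T), join A <= x <-> ubound A x;
  meet_join_distr : forall (a : T) (A : set T),
    meet a (join A) = join [set meet a b | b in A]
}.

HB.builders Context d T of POrder_isFrame d T.

Definition bot : T := join set0.
Definition join2 (x y : T) : T := join [set x; y].

Fact le0x x : bot <= x. Proof. by apply/join_lub => y []. Qed.

Fact leUx (x y z : T) : (join2 x y <= z) = (x <= z) && (y <= z).
Proof.
apply/idP/andP => [/join_lub h|[hx hy]]; first by split; apply: h; [left|right].
by apply/join_lub => _ [] ->.
Qed.

Fact meetC : commutative meet.
Proof.
have h x y : meet x y <= meet y x.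
  by have := lexx (meet x y); rewrite !lexI => /andP[-> ->].
by move=> x y; apply/le_anti/andP.
Qed.

Fact meetP : forall x y z : T, (x <= meet y z) = (x <= y) && (x <= z).
Proof. exact: lexI. Qed.

HB.instance Definition _ := Order.hasBottom.Build d T le0x.
HB.instance Definition _ := Order.hasTop.Build d T lex1.
HB.instance Definition _ := Order.POrder_MeetJoin_isLattice.Build d T meetP leUx.

Fact meetUl : @left_distributive T T (@Order.meet d T) (@Order.join d T).
Proof.
move=> x y z; rewrite ![_ `&` z]meetC.
change (meet z (join [set x; y]) = join [set meet z x; meet z y]).
rewrite meet_join_distr; congr join; apply/seteqP; split => t /=.
  by case=> _ [] -> <-; [left|right].
by case=> ->; [exists x => //; left|exists y => //; right].
Qed.

HB.instance Definition _ := Order.Lattice_Meet_isDistrLattice.Build d T meetUl.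
HB.instance Definition _ := isFrame.Build d T join_lub meet_join_distr.
HB.end.

Section FrameTheory.
Context d (T : frameType d).
Implicit Types (a b c x y : T) (A B : set T).

Definition fmeet A : T := fjoin (lbound A).

(* Heyting implication *)
Definition fimp a b : T := fjoin [set x | x `&` a <= b].

Lemma fjoin_le A x : ubound A x -> fjoin A <= x.
Proof. by move/fjoin_lub. Qed.

Lemma le_fjoin A x : A x -> x <= fjoin A.
Proof. by move=> Ax; have /fjoin_lub := lexx (fjoin A); apply. Qed.

Lemma fjoinE A x : ubound A x -> lbound (ubound A) x -> fjoin A = x.
Proof.
move=> ub lst; apply/le_anti/andP; split; first exact: fjoin_le.
by apply: lst => y; exact: le_fjoin.
Qed.

Lemma fmeet_glb A x : x <= fmeet A <-> lbound A x.
Proof.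
split=> [h y Ay|h]; last exact: le_fjoin.
by apply: le_trans h _; apply: fjoin_le => z; apply.
Qed.

Lemma le_fmeet A x : lbound A x -> x <= fmeet A.
Proof. by move/fmeet_glb. Qed.

Lemma fmeet_le A x : A x -> fmeet A <= x.
Proof. by move=> Ax; have /fmeet_glb := lexx (fmeet A); apply. Qed.

Lemma fimpP x a b : (x <= fimp a b) = (x `&` a <= b).
Proof.
apply/idP/idP => [h|h]; last exact: le_fjoin.
apply: le_trans (leI2 h (lexx a)) _.
rewrite meetC meet_fjoin; apply: fjoin_le => _ [y yab <-].
by rewrite meetC.
Qed.

Lemma lt1_neq x : (x < \top) = (x != \top).
Proof. by rewrite lt_neqAle lex1 andbT. Qed.

End FrameTheory.

Definition frame_hom d (L : frameType d) d' (M : frameType d') (f : L -> M) :=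
  [/\ f \top = \top,
      forall x y, f (x `&` y) = f x `&` f y &
      forall A, f (fjoin A) = fjoin (f @` A)].

Definition surj d (L : frameType d) d' (M : frameType d') (f : L -> M) :=
  forall y, exists x, f x = y.

Section HomTheory.
Context d1 (L : frameType d1) d2 (M : frameType d2) d3 (N : frameType d3).

Lemma frame_hom_comp (g : M -> N) (f : L -> M) :
  frame_hom g -> frame_hom f -> frame_hom (g \o f).
Proof.
move=> [g1 gI gJ] [f1 fI fJ]; split=> [|x y|A] /=; first by rewrite f1.
- by rewrite fI.
- by rewrite fJ gJ image_comp.
Qed.

Lemma frame_hom0 (f : L -> M) : frame_hom f -> f \bot = \bot.
Proof.
move=> [_ _ fJ].
have e d (T : frameType d) : \bot = fjoin set0 :> T.
  by apply/le_anti; rewrite le0x /=; apply: fjoin_le => ? [].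
by rewrite !e fJ image_set0.
Qed.

Lemma frame_homU (f : L -> M) x y : frame_hom f -> f (x `|` y) = f x `|` f y.
Proof.
move=> [_ _ fJ].
have e d (T : frameType d) (u v : T) : u `|` v = fjoin [set u; v].
  apply/esym/fjoinE => [_ [] ->|z h]; rewrite ?leUl ?leUr //.
  by rewrite leUx !h //; [right|left].
by rewrite !e fJ image_setU !image_set1.
Qed.

Lemma frame_hom_le (f : L -> M) x y : frame_hom f -> x <= y -> f x <= f y.
Proof. by move=> [_ fI _] /meet_idPl h; apply/meet_idPl; rewrite -fI h. Qed.

End HomTheory.

Section CompleteRegularity.
Context d (T : frameType d).
Implicit Types a b : T.

Definition rather_below a b := exists c, a `&` c = \bot /\ b `|` c = \top.

(* A scale from a to b indexed by the rationals of [0, 1]; the values of c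
   outside [0, 1] are irrelevant. *)
Definition completely_below a b := exists c : rat -> T,
  [/\ c 0%R = a, c 1%R = b &
      forall p q : rat, (0 <= p)%R -> (p < q)%R -> (q <= 1)%R ->
        rather_below (c p) (c q)].

Definition completely_regular :=
  forall a, a = fjoin [set b | completely_below b a].

End CompleteRegularity.
Arguments completely_regular {d} T.

Lemma completely_below_hom d (L : frameType d) d' (M : frameType d')
    (f : L -> M) a b :
  frame_hom f -> completely_below a b -> completely_below (f a) (f b).
Proof.
move=> hf [c [<- <- hc]]; exists (f \o c); split=> // p q p0 pq q1.
have [z [z1 z2]] := hc p q p0 pq q1; exists (f z).
by case: (hf) => f1 fI _; rewrite /= -fI -frame_homU // z1 z2 frame_hom0.
Qed.

Lemma completely_below_le d (T : frameType d) (a b : T) :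
  completely_below a b -> a <= b.
Proof.
move=> [c [<- <- /(_ 0%R 1%R (lexx _) ltr01 (lexx _))[z [h1 h2]]]].
by rewrite -[c 0%R]meetx1 -h2 meetUr h1 joinx0 leIr.
Qed.

Section Regularity.
Context d (T : frameType d).

Definition cr_elements : set T :=
  [set a | a = fjoin [set b | completely_below b a]].

Lemma cr_elementsP (a : T) :
  (a <= fjoin [set b | completely_below b a]) -> cr_elements a.
Proof.
move=> h; apply/le_anti; rewrite h /=.
by apply: fjoin_le => b; exact: completely_below_le.
Qed.

Lemma rather_below_trans (a b a' b' : T) :
  a' <= a -> b <= b' -> rather_below a b -> rather_below a' b'.
Proof.
move=> aa bb [c [h1 h2]]; exists c; split; apply/le_anti.
  by rewrite le0x andbT -h1 leI2.
by rewrite lex1 /= -h2 leU2.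
Qed.

Lemma rather_belowI (a b a' b' : T) :
  rather_below a b -> rather_below a' b' -> rather_below (a `&` a') (b `&` b').
Proof.
move=> [c [h1 h2]] [c' [h1' h2']]; exists (c `|` c'); split.
  by rewrite meetUr -meetA [a' `&` c]meetC meetA h1 meet0x join0x -meetA h1' meetx0.
by rewrite joinIl joinA h2 join1x meet1x [c `|` c']joinC joinA h2' join1x.
Qed.

Lemma completely_belowI (a b a' b' : T) :
  completely_below a b -> completely_below a' b' ->
  completely_below (a `&` a') (b `&` b').
Proof.
move=> [c [<- <- h]] [c' [<- <- h']]; exists (fun p => c p `&` c' p).
by split=> // p q p0 pq q1; apply: rather_belowI; [apply: h|apply: h'].
Qed.

Lemma completely_below_top : completely_below (\top : T) \top.
Proof.
exists (fun=> \top); split=> // p q _ _ _; exists \bot.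
by rewrite meetx0 joinx0.
Qed.

Lemma completely_below_trans (a b b' : T) :
  completely_below a b -> b <= b' -> completely_below a b'.
Proof.
move=> [c [ca cb h]] bb; exists (fun p => if p == 1%R then b' else c p).
rewrite eq_sym oner_eq0 eqxx; split=> // p q p0 pq q1.
have /negPf -> : p != 1%R by rewrite lt_eqF // (lt_le_trans pq).
case: eqP => [q1'|_]; last exact: h.
by apply: rather_below_trans (h _ _ p0 pq q1); rewrite // q1' cb.
Qed.

Lemma cr_elements_top : cr_elements \top.
Proof. by apply: cr_elementsP; apply: le_fjoin; exact: completely_below_top. Qed.

Lemma cr_elementsI (a b : T) :
  cr_elements a -> cr_elements b -> cr_elements (a `&` b).
Proof.
move=> ha hb; apply: cr_elementsP; rewrite {1}ha {1}hb meet_fjoin.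
apply: fjoin_le => _ [y yb <-]; rewrite meetC meet_fjoin.
apply: fjoin_le => _ [x xa <-]; rewrite meetC; apply: le_fjoin.
exact: completely_belowI.
Qed.

Lemma cr_elements_join (A : set T) : A `<=` cr_elements -> cr_elements (fjoin A).
Proof.
move=> hA; apply: cr_elementsP; apply: fjoin_le => a Aa.
rewrite (hA _ Aa); apply: fjoin_le => b ba; apply: le_fjoin => /=.
by apply: completely_below_trans ba _; exact: le_fjoin.
Qed.

End Regularity.

Record subframe d (T : frameType d) := Subframe {
  sf_set :> set T;
  sf_top : sf_set \top;
  sf_meet : forall x y, sf_set x -> sf_set y -> sf_set (x `&` y);
  sf_join : forall A, A `<=` sf_set -> sf_set (fjoin A)
}.

Definition subframe_type d (T : frameType d) (K : subframe T) : Type :=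
  set_type K.

Section SubframeFrame.
Context d (T : frameType d) (K : subframe T).
Local Notation U := (subframe_type K).

HB.instance Definition _ := SubChoice.on U.
HB.instance Definition _ := [SubChoice_isSubPOrder of U by <: with d].

Lemma sf_mem (x : U) : sf_set K (val x).
Proof. by have := valP x; rewrite inE. Qed.

Definition sf_mk (x : T) (Kx : sf_set K x) : U := exist _ x (mem_set Kx).

Let sftop : U := sf_mk (sf_top K).
Let sfmeet (x y : U) : U := sf_mk (sf_meet (sf_mem x) (sf_mem y)).

Lemma sf_join_subproof (A : set U) : sf_set K (fjoin (val @` A)).
Proof. by apply: sf_join => _ [x _ <-]; exact: sf_mem. Qed.

Let sfjoin (A : set U) : U := sf_mk (sf_join_subproof A).

Fact sf_lex1 x : x <= sftop. Proof. by rewrite -Order.le_val lex1. Qed.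

Fact sf_lexI x y z : (x <= sfmeet y z) = (x <= y) && (x <= z).
Proof. by rewrite -!Order.le_val lexI. Qed.

Fact sf_join_lub (A : set U) x : sfjoin A <= x <-> ubound A x.
Proof.
rewrite -Order.le_val; split=> [h y Ay|h]; last first.
  by apply: fjoin_le => _ [y Ay <-]; rewrite Order.le_val; exact: h.
by rewrite -Order.le_val; apply: le_trans h; apply: le_fjoin; exists y.
Qed.

Fact sf_meet_join (a : U) (A : set U) :
  sfmeet a (sfjoin A) = sfjoin [set sfmeet a b | b in A].
Proof.
by apply: val_inj; rewrite /= meet_fjoin !image_comp.
Qed.

HB.instance Definition _ :=
  POrder_isFrame.Build d U sf_lex1 sf_lexI sf_join_lub sf_meet_join.

Lemma sf_val_hom : frame_hom (val : U -> T).
Proof. by []. Qed.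

End SubframeFrame.

Lemma subframe_lift d (T : frameType d) d' (M : frameType d') (K : subframe T)
    (f : M -> T) (fK : forall x, sf_set K (f x)) :
  frame_hom f -> frame_hom (fun x => sf_mk (fK x)).
Proof.
move=> [f1 fI fJ]; split=> [|x y|A]; apply: val_inj => //=.
by rewrite fJ image_comp.
Qed.

Section LargestCompletelyRegular.
Context d (T : frameType d).

(* The union of the completely regular subframes contained in P. For a
   subframe P it is itself such a subframe, hence the largest one: see
   [largest_cr_sub], [largest_cr_cr] and [largest_cr_max]. *)
Definition largest_cr_set (P : set T) : set T :=
  [set x | exists K : subframe T,
    [/\ completely_regular (subframe_type K), K `<=` P & sf_set K x]].

Section Gen.
Variables (P : subframe T).
Let U := largest_cr_set P.

Let genset : set T := [set x | forall K : subframe T, U `<=` K -> sf_set K x].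

Let gen_top : genset \top. Proof. by move=> K _; exact: sf_top. Qed.
Let gen_meet x y : genset x -> genset y -> genset (x `&` y).
Proof. by move=> gx gy K hK; apply: sf_meet; [exact: gx|exact: gy]. Qed.
Let gen_join A : A `<=` genset -> genset (fjoin A).
Proof. by move=> hA K hK; apply: sf_join => x /hA; exact. Qed.
Let gen : subframe T := Subframe gen_top gen_meet gen_join.

Let gen_sub : gen `<=` P.
Proof. by move=> x; apply=> y [K [_ KP]]; exact: KP. Qed.

Let U_gen : U `<=` gen.
Proof. by move=> x Ux K; exact. Qed.

Let regset : set T :=
  [set x | exists h : sf_set gen x, cr_elements (sf_mk h : subframe_type gen)].

Let sfE (x y : subframe_type gen) : val x = val y -> x = y.
Proof. exact: val_inj. Qed.

Let reg_top : regset \top.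
Proof.
exists gen_top; have := cr_elements_top (subframe_type gen).
by congr cr_elements; exact: sfE.
Qed.
Let reg_meet x y : regset x -> regset y -> regset (x `&` y).
Proof.
move=> [hx cx] [hy cy]; exists (gen_meet hx hy); have := cr_elementsI cx cy.
by congr cr_elements; exact: sfE.
Qed.
Let reg_join A : A `<=` regset -> regset (fjoin A).
Proof.
move=> hA; have hg : A `<=` genset by move=> x /hA[].
exists (gen_join hg).
pose B : set (subframe_type gen) := [set x | A (val x)].
have BA : val @` B = A.
  apply/seteqP; split=> [_ [x Bx <-] //|x Ax].
  by exists (sf_mk (hg _ Ax : sf_set gen x)).
have /cr_elements_join : B `<=` @cr_elements _ (subframe_type gen).
  move=> x /hA[h]; congr cr_elements; exact: sfE.
by congr cr_elements; apply: sfE; rewrite /= BA.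
Qed.
Let reg : subframe T := Subframe reg_top reg_meet reg_join.

Let gen_cr : completely_regular (subframe_type gen).
Proof.
suff U_reg : U `<=` reg.
  move=> x; have [h] : sf_set reg (val x) by apply: (sf_mem x); exact: U_reg.
  by have -> : sf_mk h = x by exact: sfE.
move=> x Ux; exists (U_gen Ux); case: (Ux) => K [Kcr KP Kx].
have KG y : sf_set gen (val (y : subframe_type K)).
  by apply: U_gen; exists K; split=> //; exact: sf_mem.
have hi := subframe_lift KG (sf_val_hom K).
set i := (fun _ => _) in hi.
suff : cr_elements (i (sf_mk Kx)) by congr cr_elements; exact: sfE.
apply: cr_elementsP; rewrite {1}(Kcr (sf_mk Kx)).
case: (hi) => _ _ ->; apply: fjoin_le => _ [y hy <-]; apply: le_fjoin.
exact: completely_below_hom.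
Qed.

Let U_eq : U = gen :> set T.
Proof.
apply/seteqP; split; first exact: U_gen.
by move=> x gx; exists gen; split.
Qed.

Lemma largest_cr_top : largest_cr_set P \top.
Proof. by rewrite -/U U_eq; exact: sf_top. Qed.
Lemma largest_cr_meet x y :
  largest_cr_set P x -> largest_cr_set P y -> largest_cr_set P (x `&` y).
Proof. by rewrite -/U U_eq; exact: sf_meet. Qed.
Lemma largest_cr_join A :
  A `<=` largest_cr_set P -> largest_cr_set P (fjoin A).
Proof. by rewrite -/U U_eq; exact: sf_join. Qed.

Definition largest_cr : subframe T :=
  Subframe largest_cr_top largest_cr_meet largest_cr_join.

Lemma largest_cr_sub : largest_cr `<=` P.
Proof. by move=> x [K [_ KP]]; exact: KP. Qed.

Lemma largest_cr_cr : completely_regular (subframe_type largest_cr).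
Proof.
suff -> : largest_cr = gen by exact: gen_cr.
have irr (K K' : subframe T) : K = K' :> set T -> K = K'.
  case: K K' => [A a b c] [A' a' b' c'] /= e; case: _ / e a' b' c' => a' b' c'.
  by congr Subframe; exact: Prop_irrelevance.
exact: irr.
Qed.

Lemma largest_cr_max (K : subframe T) :
  completely_regular (subframe_type K) -> K `<=` P -> K `<=` largest_cr.
Proof. by move=> Kcr KP x Kx; exists K. Qed.

End Gen.
End LargestCompletelyRegular.

Section ProductFrame.
Context (d d1 d2 : Order.disp_t) (E : frameType d1) (M : frameType d2).
Local Notation P := (E *prod[d] M)%type.

Let pjoin (A : set P) : P := (fjoin [set p.1 | p in A], fjoin [set p.2 | p in A]).

Fact prod_join_lub (A : set P) x : pjoin A <= x <-> ubound A x.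
Proof.
rewrite leEprod /=; split=> [/andP[h1 h2] y Ay|h].
  rewrite leEprod; apply/andP; split.
    by apply: le_trans h1; apply: le_fjoin; exists y.
  by apply: le_trans h2; apply: le_fjoin; exists y.
by apply/andP; split; apply: fjoin_le => _ [y /h + <-];
  rewrite leEprod => /andP[].
Qed.

Fact prod_meet_join (a : P) (A : set P) :
  a `&` pjoin A = pjoin [set a `&` b | b in A].
Proof. by rewrite /pjoin !meetEprod /= !meet_fjoin !image_comp. Qed.

HB.instance Definition _ := isFrame.Build d P prod_join_lub prod_meet_join.

Lemma fst_hom : frame_hom (fst : P -> E).
Proof. by []. Qed.

Lemma snd_hom : frame_hom (snd : P -> M).
Proof. by []. Qed.

End ProductFrame.

Record sublocale d (T : frameType d) := Sublocale {
  sl_set :> set T;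
  sl_meet : forall A, A `<=` sl_set -> sl_set (fmeet A);
  sl_imp : forall x s, sl_set s -> sl_set (fimp x s)
}.

Definition sublocale_type d (T : frameType d) (S : sublocale T) : Type :=
  set_type S.

Section SublocaleFrame.
Context d (T : frameType d) (S : sublocale T).
Local Notation U := (sublocale_type S).

HB.instance Definition _ := SubChoice.on U.
HB.instance Definition _ := [SubChoice_isSubPOrder of U by <: with d].

Lemma sl_mem (x : U) : sl_set S (val x).
Proof. by have := valP x; rewrite inE. Qed.

Definition sl_mk (x : T) (Sx : sl_set S x) : U := exist _ x (mem_set Sx).

Lemma nucleus_subproof (b : T) : sl_set S (fmeet [set a | sl_set S a /\ b <= a]).
Proof. by apply: sl_meet => a []. Qed.

Definition nucleus (b : T) : U := sl_mk (nucleus_subproof b).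

Lemma nucleus_le (b : T) (x : U) : (nucleus b <= x) = (b <= val x).
Proof.
rewrite -Order.le_val; apply/idP/idP => h.
  by apply: le_trans h; apply: le_fmeet => a [].
by apply: fmeet_le; split=> //; exact: sl_mem.
Qed.

Lemma nucleusK : cancel val nucleus.
Proof.
move=> x; apply/le_anti; rewrite nucleus_le lexx /=.
by rewrite -Order.le_val; apply: le_fmeet => a [].
Qed.

Lemma le_nucleus (b : T) : b <= val (nucleus b).
Proof. by rewrite -nucleus_le. Qed.

Lemma sl_topP : sl_set S \top.
Proof.
have -> : \top = fmeet set0 :> T; last exact: sl_meet.
by apply/le_anti; rewrite lex1 andbT; apply: le_fmeet => a [].
Qed.

Lemma sl_meet2P x y : sl_set S x -> sl_set S y -> sl_set S (x `&` y).
Proof.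
move=> Sx Sy; have -> : x `&` y = fmeet [set x; y]; last first.
  by apply: sl_meet => _ [] ->.
apply/le_anti/andP; split.
  by apply: le_fmeet => _ [] ->; rewrite ?leIl ?leIr.
by rewrite lexI; apply/andP; split; apply: fmeet_le; [left|right].
Qed.

Let sltop : U := sl_mk sl_topP.
Let slmeet (x y : U) : U := sl_mk (sl_meet2P (sl_mem x) (sl_mem y)).
Let sljoin (A : set U) : U := nucleus (fjoin (val @` A)).

Fact sl_lex1 x : x <= sltop. Proof. by rewrite -Order.le_val lex1. Qed.

Fact sl_lexI x y z : (x <= slmeet y z) = (x <= y) && (x <= z).
Proof. by rewrite -!Order.le_val lexI. Qed.

Fact sl_join_lub (A : set U) x : sljoin A <= x <-> ubound A x.
Proof.
rewrite nucleus_le; split=> [h y Ay|h]; last first.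
  by apply: fjoin_le => _ [y Ay <-]; rewrite Order.le_val; exact: h.
by rewrite -Order.le_val; apply: le_trans h; apply: le_fjoin; exists y.
Qed.

Fact sl_meet_join (a : U) (A : set U) :
  slmeet a (sljoin A) = sljoin [set slmeet a b | b in A].
Proof.
apply/le_anti/andP; split; last first.
  apply/sl_join_lub => _ [b Ab <-]; rewrite sl_lexI.
  have /andP[-> /le_trans -> //] : (slmeet a b <= a) && (slmeet a b <= b).
    by rewrite -sl_lexI.
  by have /sl_join_lub := lexx (sljoin A); apply.
set y := sljoin [set _ | _ in _].
suff h : val (sljoin A) <= fimp (val a) (val y).
  by move: h; rewrite fimpP meetC => h; rewrite -Order.le_val; exact: h.
have Sy : sl_set S (fimp (val a) (val y)) by apply: sl_imp; exact: sl_mem.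
apply: fmeet_le; split; [exact: Sy|apply: fjoin_le => _ [b Ab <-]].
rewrite fimpP meetC; have /sl_join_lub/(_ (slmeet a b)) := lexx y.
by rewrite -Order.le_val; apply; exists b.
Qed.

HB.instance Definition _ :=
  POrder_isFrame.Build d U sl_lex1 sl_lexI sl_join_lub sl_meet_join.

Lemma nucleus_hom : frame_hom nucleus.
Proof.
split=> [|x y|A].
- by apply/le_anti; rewrite lex1 /=; exact: le_nucleus.
- apply/le_anti/andP; split.
    rewrite lexI !nucleus_le !(le_trans _ (le_nucleus _)) ?leIl ?leIr //.
  set z := nucleus (x `&` y).
  have h u v : u `&` v <= val z -> val (nucleus u) `&` v <= val z.
    rewrite -fimpP => uv; rewrite -fimpP; apply: fmeet_le; split=> //.
    by apply: sl_imp; exact: sl_mem.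
  rewrite -Order.le_val; apply: (h x).
  by rewrite meetC; apply: h; rewrite meetC; exact: le_nucleus.
- apply/esym/fjoinE => [_ [x Ax <-]|z hz].
    by rewrite nucleus_le (le_trans (le_fjoin Ax)) // le_nucleus.
  rewrite nucleus_le; apply: fjoin_le => x Ax; rewrite -nucleus_le.
  by apply: hz; exists x.
Qed.

End SublocaleFrame.

Section PointlessSpatial.
Context d (L : frameType d).
Implicit Types a b c x y : L.

Definition successor a c := a < c /\ ~ exists b, a < b /\ b < c.

Definition max_elements : set L :=
  [set a | a != \top /\ forall b, b != \top -> a <= b -> b = a].

Definition pointless_set : set L := [set a | ~ exists c, successor a c].

Definition spatial_set : set L :=
  [set b | b = fmeet [set a | max_elements a /\ b <= a]].

Lemma successorP a c :
  successor a c <-> a < c /\ forall b, a <= b -> b <= c -> b = a \/ b = c.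
Proof.
split=> -[ac h]; split=> //.
  move=> b ab bc; have [->|ba] := eqVneq b a; first by left.
  have [->|cb] := eqVneq b c; first by right.
  by case: h; exists b; rewrite !lt_neqAle eq_sym ba cb.
move=> [b [ab bc]]; case: (h b (ltW ab) (ltW bc)) => e.
  by rewrite e ltxx in ab.
by rewrite e ltxx in bc.
Qed.

Lemma pointless_meet (A : set L) :
  A `<=` pointless_set -> pointless_set (fmeet A).
Proof.
move=> hA [c /successorP[ac h]]; set a := fmeet A in ac h.
have /existsNP[a1 /not_implyP[Aa1 na1]] : ~ lbound A c.
  by move=> /fmeet_glb/(lt_le_trans ac); rewrite ltxx.
have aa1 : a <= a1 by exact: fmeet_le.
have e : c `&` a1 = a.
  case: (h (c `&` a1)) => //; rewrite ?lexI ?(ltW ac) ?leIl //.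
  by move=> e; case: na1; rewrite -e leIr.
apply: (hA _ Aa1); exists (a1 `|` c); apply/successorP; split.
  rewrite lt_neqAle leUl andbT; apply/eqP => e1; apply: na1.
  by rewrite e1 leUr.
move=> b ab bc.
have eb : b = a1 `|` (b `&` c).
  apply/le_anti; rewrite leUx ab leIl /= andbT.
  by rewrite joinIr lexI leUr bc.
case: (h (b `&` c)) => [|| e1|e1].
- by rewrite lexI (ltW ac) (le_trans aa1).
- exact: leIr.
- by left; rewrite eb e1; apply/join_idPl.
- by right; rewrite eb e1.
Qed.

Lemma pointless_imp a x : pointless_set x -> pointless_set (fimp a x).
Proof.
move=> hx [c /successorP[xc h]]; set x' := fimp a x in xc h.
have x'a : x' `&` a <= x by rewrite -fimpP.
have xx' : x <= x' by rewrite fimpP leIl.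
apply: hx; exists (x `|` (c `&` a)); apply/successorP; split.
  rewrite lt_neqAle leUl andbT; apply/eqP => e.
  have : c <= x' by rewrite fimpP e leUr.
  by move/(lt_le_trans xc); rewrite ltxx.
move=> y xy yc.
have ey : y = x `|` (y `&` (c `&` a)).
  apply/le_anti; rewrite leUx xy leIl /= andbT.
  by rewrite joinIr lexI leUr yc.
set y' := y `&` (c `&` a) in ey.
have y'c : y' <= c by rewrite /y' (le_trans (leIr _ _)) // leIl.
case: (h (x' `|` y')) => [|| e|e].
- exact: leUl.
- by rewrite leUx (ltW xc).
- left; rewrite ey; apply/join_idPl.
  apply: le_trans x'a; rewrite lexI -{1}e leUr /=.
  by rewrite /y' (le_trans (leIr _ _)) // leIr.
- right; apply/le_anti; rewrite yc /= leUx xy /= -e meetUl leUx.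
  by rewrite (le_trans x'a) //= (le_trans (leIl _ _)) // leIl.
Qed.

Lemma max_lt1 a : max_elements a -> a < \top.
Proof. by case=> h _; rewrite lt1_neq. Qed.

Lemma max_joinP a b : max_elements a -> ~~ (b <= a) -> a `|` b = \top.
Proof.
move=> [a1 h] ba; apply/eqP; apply: contraNT ba => /h/(_ (leUl _ _)) <-.
exact: leUr.
Qed.

Lemma max_prime a b c : max_elements a -> b `&` c <= a -> ~~ (b <= a) -> c <= a.
Proof.
move=> am bca ba; rewrite -[c]meet1x -(max_joinP am ba) meetUl leUx bca.
by rewrite leIl.
Qed.

Lemma spatial_le b : b <= fmeet [set a | max_elements a /\ b <= a].
Proof. by apply: le_fmeet => a []. Qed.

Lemma spatialP b :
  (forall x, (forall a, max_elements a -> b <= a -> x <= a) -> x <= b) ->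
  spatial_set b.
Proof.
move=> h; apply/le_anti; rewrite spatial_le /=; apply: h => a am ba.
exact: fmeet_le.
Qed.

Lemma spatialE b x : spatial_set b ->
  (forall a, max_elements a -> b <= a -> x <= a) -> x <= b.
Proof.
move=> hb h; rewrite (hb : b = _).
by apply: le_fmeet => a [am]; exact: h.
Qed.

Lemma spatial_meet (A : set L) : A `<=` spatial_set -> spatial_set (fmeet A).
Proof.
move=> hA; apply: spatialP => x hx; apply: le_fmeet => b Ab.
apply: (spatialE (hA _ Ab)) => a am ba; apply: hx => //.
by apply: le_trans ba; exact: fmeet_le.
Qed.

Lemma spatial_imp x s : spatial_set s -> spatial_set (fimp x s).
Proof.
move=> hs; apply: spatialP => y hy; rewrite fimpP; apply: (spatialE hs).
move=> a am sa; have [xa|xa] := boolP (x <= a); first by rewrite leIx2 ?xa ?orbT.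
rewrite leIx2 // hy //; apply: (max_prime am _ xa).
by rewrite meetC (le_trans _ sa) // -fimpP.
Qed.

Lemma spatial_map_subproof b :
  spatial_set (fmeet [set a | max_elements a /\ b <= a]).
Proof.
apply: spatial_meet => a [am _]; apply: spatialP => x; exact.
Qed.

Lemma max_spatial a : max_elements a -> spatial_set a.
Proof. by move=> am; apply: spatialP => x; exact. Qed.

Definition pointless_sublocale : sublocale L :=
  Sublocale pointless_meet pointless_imp.

Definition spatial_sublocale : sublocale L :=
  Sublocale spatial_meet spatial_imp.

Definition pointless_part : frameType d := sublocale_type pointless_sublocale.
Definition spatial_part : frameType d := sublocale_type spatial_sublocale.

Definition pointless_map : L -> pointless_part := nucleus pointless_sublocale.

(* [spatial_mapE] identifies it with the nucleus of the sublocale. *)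
Definition spatial_map (b : L) : spatial_part :=
  sl_mk (S := spatial_sublocale) (spatial_map_subproof b).

Lemma spatial_mapE : spatial_map = nucleus spatial_sublocale.
Proof.
apply/funext => b; apply: val_inj => /=; apply/le_anti/andP; split.
  apply: le_fmeet => x [hx bx]; rewrite (hx : x = _).
  apply: le_fmeet => a [am xa]; apply: fmeet_le; split=> //.
  exact: le_trans xa.
by apply: le_fmeet => a [am ba]; apply: fmeet_le; split=> //; exact: max_spatial.
Qed.

Lemma pointless_map_hom : frame_hom pointless_map.
Proof. exact: nucleus_hom. Qed.

Lemma spatial_map_hom : frame_hom spatial_map.
Proof. by rewrite spatial_mapE; exact: nucleus_hom. Qed.

Lemma pointless_map_surj : surj pointless_map.
Proof. by move=> y; exists (val y); exact: nucleusK. Qed.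

Lemma spatial_map_surj : surj spatial_map.
Proof. by move=> y; exists (val y); rewrite spatial_mapE; exact: nucleusK. Qed.

End PointlessSpatial.

Section Ligature.
Context d (L : frameType d).

Lemma spatial_pointless (x : spatial_part L) :
  pointless_set x -> pointless_set (val x).
Proof.
move=> hx [c /successorP[xc h]]; apply: hx.
have hvx : spatial_set (val x) by exact: (sl_mem x).
have [a [am xa ca]] : exists a, [/\ max_elements a, val x <= a & ~~ (c <= a)].
  apply: contrapT => H; suff : c <= val x.
    by move/(lt_le_trans xc); rewrite ltxx.
  apply: (spatialE hvx) => a am xa; apply: contrapT => /negP ca.
  by apply: H; exists a.
have cax : c `&` a = val x.
  case: (h (c `&` a)) => [|| //|e]; rewrite ?leIl ?lexI ?(ltW xc) //.
  by rewrite -e leIr in ca.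
have uniq_a m : max_elements m -> val x <= m -> ~~ (c <= m) -> m = a.
  move=> mm xm cm; case: (am) => _; apply; first by case: mm.
  by apply: (max_prime mm _ cm); rewrite cax.
have cP y : (spatial_map c <= y) = (c <= val y).
  by rewrite spatial_mapE nucleus_le.
exists (spatial_map c); apply/successorP; split.
  have cs : c <= val (spatial_map c) by rewrite -cP.
  rewrite lt_neqAle; apply/andP; split.
    by apply: contra ca => /eqP e; apply: le_trans xa; rewrite e.
  by rewrite -Order.le_val (le_trans (ltW xc)).
move=> y xy yc; have hvy : spatial_set (val y) by exact: (sl_mem y).
have vxy : val x <= val y by rewrite Order.le_val.
have [ya|ya] := boolP (val y <= a).
  left; apply/le_anti; rewrite xy andbT -Order.le_val.
  apply: (spatialE hvx) => m mm xm.
  have [cm|cm] := boolP (c <= m); last by rewrite (uniq_a m).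
  apply: (@le_trans _ _ (val (spatial_map c))); first by rewrite Order.le_val.
  exact: fmeet_le.
right; apply/le_anti; rewrite yc cP /=; apply: (spatialE hvy) => m mm ym.
have xm : val x <= m by exact: le_trans ym.
by apply: contrapT => /negP cm; move: ym; rewrite (uniq_a m) ?(negPf ya).
Qed.

(* The value is forced on [pointless_part L], where [pointless_map] is the
   identity ([nucleusK]); [ligature_hom], [ligatureE] and [ligature_unique]
   show that this is the unique frame homomorphism commuting with the
   quotient maps. *)
Definition ligature (a : pointless_part L) : pointless_part (spatial_part L) :=
  pointless_map (spatial_map (val a)).

Lemma ligatureE b :
  ligature (pointless_map b) = pointless_map (spatial_map b).
Proof.
apply/le_anti/andP; split; last first.
  have [_ h1 _] := pointless_map_hom L; have [_ h2 _] := spatial_map_hom L.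
  apply: (frame_hom_le (pointless_map_hom _)).
  exact: (frame_hom_le (spatial_map_hom _) (le_nucleus _ _)).
pose y := pointless_map (spatial_map b); rewrite -/y nucleus_le.
have hy : pointless_set (val (val y)) by exact: spatial_pointless (sl_mem y).
rewrite spatial_mapE nucleus_le; apply: fmeet_le; split; first exact: hy.
by rewrite -nucleus_le -spatial_mapE; exact: le_nucleus.
Qed.

Lemma ligature_hom : frame_hom ligature.
Proof.
have [t1 tI tJ] := frame_hom_comp (pointless_map_hom _) (spatial_map_hom L).
split=> [|x y|A]; first exact: t1.
- exact: tI.
- rewrite ligatureE; have /= -> := tJ (val @` A); rewrite image_comp.
  by congr fjoin; apply: eq_imagel.
Qed.

Lemma ligature_unique (f : pointless_part L -> pointless_part (spatial_part L)) :
  frame_hom f ->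
  (forall b, f (pointless_map b) = pointless_map (spatial_map b)) ->
  f = ligature.
Proof.
move=> _ h; apply/funext => x; have [b <-] := pointless_map_surj x.
by rewrite h ligatureE.
Qed.

Definition ligature_pullback_set : set (pointless_part L *p spatial_part L) :=
  [set p | ligature p.1 = pointless_map p.2].

Lemma ligature_pullback_top : ligature_pullback_set \top.
Proof.
by have [h _ _] := ligature_hom; have [h' _ _] := pointless_map_hom (spatial_part L);
  rewrite /ligature_pullback_set /= h h'.
Qed.

Lemma ligature_pullback_meet x y : ligature_pullback_set x ->
  ligature_pullback_set y -> ligature_pullback_set (x `&` y).
Proof.
have [_ h _] := ligature_hom; have [_ h' _] := pointless_map_hom (spatial_part L).
by rewrite /ligature_pullback_set /= h h' => -> ->.
Qed.

Lemma ligature_pullback_join A : A `<=` ligature_pullback_set ->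
  ligature_pullback_set (fjoin A).
Proof.
have [_ _ h] := ligature_hom; have [_ _ h'] := pointless_map_hom (spatial_part L).
move=> hA; rewrite /ligature_pullback_set /= h h' !image_comp.
by congr fjoin; apply: eq_imagel => p /hA.
Qed.

Definition ligature_pullback : subframe (pointless_part L *p spatial_part L) :=
  Subframe ligature_pullback_top ligature_pullback_meet ligature_pullback_join.

Definition ligature_product : subframe (pointless_part L *p spatial_part L) :=
  largest_cr ligature_pullback.

Definition pointless_spatial_map (b : L) : pointless_part L *p spatial_part L :=
  (pointless_map b, spatial_map b).

End Ligature.

Section Congruences.
Context d (L : frameType d).

(* Binary relations are sets of pairs; the last clause is preservation of
   arbitrary joins, for families of pairs given as subsets of R. *)
Definition congruence (R : set (L * L)) :=
  [/\ forall a, R (a, a),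
      forall a b, R (a, b) -> R (b, a),
      forall a b c, R (a, b) -> R (b, c) -> R (a, c),
      forall a b a' b', R (a, b) -> R (a', b') -> R (a `&` a', b `&` b') &
      forall A : set (L * L),
        A `<=` R -> R (fjoin (fst @` A), fjoin (snd @` A))].

(* [R] is the join of the family [F] in the inclusion-ordered set of
   congruences. *)
Definition is_congruence_join (F : set (set (L * L))) (R : set (L * L)) :=
  [/\ congruence R,
      forall S, F S -> S `<=` R &
      forall R', congruence R' -> (forall S, F S -> S `<=` R') -> R `<=` R'].

Definition Phi (a : L) : set (L * L) :=
  [set p | a `&` p.1 = a `&` p.2].

Definition Theta d' (M : frameType d') (e : L -> M) : set (L * L) :=
  [set p | e p.1 = e p.2].

End Congruences.

Section Classes.
Context d (L : frameType d) d' (M : frameType d').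

Definition skinny (m : L -> M) :=
  frame_hom m /\
  forall a, max_elements a -> pointless_map (m a) = \top.

Definition class_E (e : L -> M) :=
  [/\ frame_hom e, surj e &
      is_congruence_join
        [set Phi a | a in [set a | max_elements a /\ e a = \top]] (Theta e)].

(* The single-morphism case of the class of sources. *)
Definition class_M (m : L -> M) :=
  skinny m /\ forall a, max_elements a -> m a < \top.

End Classes.

Definition subdirect_EM d (E : frameType d) d' (M : frameType d')
    (K : subframe (E *p M)) :=
  [/\ completely_regular E, completely_regular M,
      completely_regular (subframe_type K),
      class_E (fun x : subframe_type K => (val x).1) &
      class_M (fun x : subframe_type K => (val x).2) /\
        surj (fun x : subframe_type K => (val x).2)].

(* Main.v *)
Require Import Defs.
From HB Require Import structures.
From mathcomp Require Import all_boot all_order all_algebra.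
From mathcomp Require Import boolp classical_sets.

(** Write [p b] and [s b] for the pointless and spatial reflections of [b],
    seen as elements of [L].

    Everything follows from a description of the elements without successor.
    In a regular frame, if [c] is a successor of [x], then some maximal [a]
    satisfies [a `&` c = x] (lemma [successor_max]): the interval [x, c] is
    perspective to an interval [a, \top]. Conversely, in any frame,
    a maximal [a] and a pointless [x] satisfy [fimp a x = x]
    (lemma [pointless_imp_max]). So the pointless part is the quotient of [L]
    that sends all maximal elements to the top, and no more
    ([Theta_pointless_sub]); this puts the map to it in the class E.

    The product map is one-one because [b = p b `&` s b]. For this, put
    [x = fimp (s b) b]. If [a] is maximal, then [fimp a x <= x]: when
    [b <= a] also [s b <= a], and otherwise [a `|` b = \top], so that
    [fimp a b = b]. Hence [x] is pointless; as [b <= x], it follows that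
    [p b <= x], which says that [p b `&` s b <= b].

    The spatial map fixes maximal elements and keeps them maximal, and the
    pointless map sends maximal elements to the top; so the spatial map is
    skinny and lies in the class M. The image [K] of [L] in the product is then
    isomorphic to [L], with inverse [(u, v) |-> u `&` v], and inherits these
    properties. Being a homomorphic image of [L], it is completely regular;
    since it lies in the pullback of the ligature, it lies in the largest
    completely regular subframe of that pullback. *)

Set Implicit Arguments.
Unset Strict Implicit.
Unset Printing Implicit Defensive.

Import Order.Theory.
Local Open Scope classical_set_scope.
Local Open Scope order_scope.

(** * Homomorphic images *)

Lemma completely_regular_surj d (L : frameType d) d' (M : frameType d')
    (f : L -> M) :
  frame_hom f -> surj f -> completely_regular L -> completely_regular M.
Proof.
move=> hf fs hL y; have [x <-] := fs y.
apply: (@cr_elementsP _ M); rewrite {1}(hL x); case: (hf) => _ _ ->.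
apply: fjoin_le => _ [b hb <-]; apply: le_fjoin.
exact: completely_below_hom.
Qed.

Section ImageSubframe.
Context d (L : frameType d) d' (M : frameType d') (f : L -> M).
Hypothesis hf : frame_hom f.

Let image_top : range f \top.
Proof. by exists \top => //; case: hf. Qed.

Let image_meet x y : range f x -> range f y -> range f (x `&` y).
Proof. by case: hf => _ fI _ [a _ <-] [b _ <-]; exists (a `&` b). Qed.

Let image_join A : A `<=` range f -> range f (fjoin A).
Proof.
case: hf => _ _ fJ hA; exists (fjoin (f @^-1` A)) => //.
rewrite fJ; congr fjoin; apply/seteqP; split=> [_ [x ? <-] //|y Ay].
by have [x _ e] := hA y Ay; exists x; rewrite // /preimage /= e.
Qed.

Definition image_subframe : subframe M :=
  Subframe image_top image_meet image_join.

Lemma image_subframe_mem x : sf_set image_subframe (f x).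
Proof. by exists x. Qed.

Definition to_image (x : L) : subframe_type image_subframe :=
  sf_mk (image_subframe_mem x).

Lemma to_image_hom : frame_hom to_image.
Proof. exact: subframe_lift. Qed.

Lemma to_image_surj : surj to_image.
Proof.
by move=> y; have [x _ e] := sf_mem y; exists x; apply: val_inj.
Qed.

End ImageSubframe.

(** * Maximal elements and successors *)

Section MaxSuccessor.
Context d (L : frameType d).
Implicit Types a b c x : L.

(** If [fimp a x] were larger than [x], it would be a successor of [x],
    because its meet with [a] is [x] and its join with [a] is [\top], while
    nothing lies between [a] and [\top]. *)
Lemma pointless_imp_max a x :
  max_elements a -> pointless_set x -> fimp a x = x.
Proof.
move=> am hx; apply/le_anti/andP; split; last by rewrite fimpP leIl.
set c := fimp a x; apply: contrapT => /negP ncx; apply: hx; exists c.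
have ca : c `&` a <= x by rewrite -fimpP.
have xc : x <= c by rewrite fimpP leIl.
apply/successorP; split; first by rewrite lt_leAnge xc.
move=> b xb bc; have [ba|ba] := boolP (b <= a).
  left; apply/le_anti; rewrite xb andbT; apply: le_trans ca.
  by rewrite lexI bc.
right; apply/le_anti; rewrite bc /= -[c]meetx1 -(max_joinP am ba) meetUr.
by rewrite leUx (le_trans ca xb) leIr.
Qed.

(** With [y] the reflection of [a], [a <= y] makes [fimp a y] the top, while
    the previous lemma makes it [y]. *)
Lemma pointless_map_max a : max_elements a -> pointless_map a = \top.
Proof.
move=> am; apply/le_anti; rewrite lex1 /= -Order.le_val.
rewrite -(pointless_imp_max am (sl_mem (pointless_map a))) fimpP.
by rewrite meet1x; exact: le_nucleus.
Qed.

Lemma spatial_map_max a : max_elements a -> max_elements (spatial_map a).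
Proof.
move=> am; have va : val (spatial_map a) = a.
  by rewrite [RHS](max_spatial am).
have [a1 h] := am; split.
  by apply: contra a1 => /eqP e; rewrite -va e.
move=> b b1; rewrite -Order.le_val va => ab; apply: val_inj; rewrite va.
by apply: h => //; apply: contra b1 => /eqP e; apply/eqP/val_inj.
Qed.

Hypothesis hL : completely_regular L.

(** Regularity gives [e] rather below [c] with [e <= x] false, hence a [z]
    disjoint from [e] with [c `|` z = \top]. Then [a = x `|` z] works: the
    successor property decides [(x `|` z) `&` c], and the value [c] would put
    [e] below [x]. *)
Lemma successor_max x c :
  successor x c -> exists2 a, max_elements a & a `&` c = x.
Proof.
move=> /successorP[xc h].
have [e [z [ez cz]] ex] : exists2 e, rather_below e c & ~~ (e <= x).
  apply: contrapT => H; suff : c <= x by rewrite lt_geF.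
  rewrite (hL c); apply: fjoin_le => e [s [s0 s1 hs]].
  apply: contrapT => /negP ne; apply: H; exists e => //.
  by rewrite -s0 -s1; apply: hs; rewrite ?lexx ?Num.Theory.ltr01.
have ac : (x `|` z) `&` c = x.
  have [|| //|ec] := h ((x `|` z) `&` c); rewrite ?leIr ?lexI ?leUl ?(ltW xc) //.
  have ec' : e <= c.
    by rewrite -[e]meetx1 -cz meetUr ez joinx0 leIr.
  have exz : e <= x `|` z by rewrite (le_trans ec') // -ec leIl.
  by case/negP: ex; rewrite -(meet_idPl exz) meetUr ez joinx0 leIr.
exists (x `|` z) => //; split.
  by apply/eqP => e1; move: ac xc; rewrite e1 meet1x => ->; rewrite ltxx.
move=> b b1 ab.
have eb : b = (x `|` z) `|` (b `&` c).
  by rewrite joinIr (join_idPr ab) -joinA [z `|` c]joinC cz joinx1 meetx1.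
have [|| e1|e1] := h (b `&` c).
- by rewrite lexI (ltW xc) (le_trans _ ab) // leUl.
- exact: leIr.
- by rewrite eb e1 joinC joinA joinxx.
- by move: b1; rewrite eb e1 -joinA [z `|` c]joinC cz joinx1 eqxx.
Qed.

Lemma pointlessP x :
  (forall a, max_elements a -> fimp a x <= x) -> pointless_set x.
Proof.
move=> hx [c sc]; have [a am ac] := successor_max sc.
have [xc _] := sc; suff : c <= x by rewrite lt_geF.
by apply: le_trans (hx a am); rewrite fimpP meetC ac.
Qed.

(** The reason is that [fimp (s b) b], with [s b] the spatial reflection, is
    pointless and lies above [b]. *)
Lemma pointless_meet_spatial b :
  val (pointless_map b) `&` val (spatial_map b) = b.
Proof.
set s := val (spatial_map b).
have bs : b <= s by exact: spatial_le.
apply/le_anti/andP; split; last by rewrite lexI le_nucleus.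
rewrite -fimpP; apply: fmeet_le; split; last by rewrite fimpP leIl.
apply: pointlessP => a am; set x := fimp s b; set y := fimp a x.
have yas : (y `&` a) `&` s <= b by rewrite -!fimpP.
rewrite fimpP; have [ba|ba] := boolP (b <= a).
  have sa : s <= a by apply: fmeet_le.
  by apply: le_trans yas; rewrite lexI leIr andbT lexI leIl (le_trans (leIr _ _)).
rewrite -[y `&` s]meetx1 -(max_joinP am ba) meetUr leUx leIr andbT.
by rewrite meetAC.
Qed.

End MaxSuccessor.

(** * The map to the pointless part and the class E *)

Section ThetaPointless.
Context d (L : frameType d).

Lemma congruence_class_join (R : set (L * L)) x : congruence R ->
  R (x, fjoin [set y | R (x, y)]).
Proof.
move=> [Rr _ _ _ RJ].
have /RJ : [set (x, y) | y in [set y | R (x, y)]] `<=` R by move=> _ [y Rxy <-].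
rewrite !image_comp /=; set u := fjoin _; set v := fjoin _.
have -> : u = x by apply: fjoinE => [_ [y _ <-] //|z]; apply; exists x.
by rewrite /v image_id.
Qed.

Hypothesis hL : completely_regular L.

(** The join [k x] of the class of [x] is pointless: a successor [c] of [k x]
    gives a maximal [a] with [a `&` c = k x], hence [c] is congruent to [k x]
    and so below it. Therefore the pointless reflection of [x] lies below
    [k x]. *)
Lemma Theta_pointless_sub (R : set (L * L)) : congruence R ->
  (forall a, max_elements a -> Phi a `<=` R) ->
  Theta (@pointless_map d L) `<=` R.
Proof.
move=> cR hR; pose k x := fjoin [set y | R (x, y)].
have Rk x : R (x, k x) by exact: congruence_class_join.
have [Rr Rs Rt RI _] := cR.
have pk x : val (pointless_map x) <= k x.
  apply: fmeet_le; split; last by apply: le_fjoin; exact: Rr.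
  move=> [c sc]; have [a am ac] := successor_max hL sc.
  suff : c <= k x by case: sc => xc _; rewrite lt_geF.
  apply: le_fjoin; apply: Rt (Rk x) _; apply: (hR a am).
  by rewrite /Phi /= -ac meetA meetxx.
move=> [x y]; rewrite /Theta /= => exy.
have half u v : pointless_map u = pointless_map v -> R (u `&` v, v).
  move=> euv; have vk : v <= k u.
    by apply: le_trans (pk u); rewrite euv; exact: le_nucleus.
  by have := RI _ _ _ _ (Rk u) (Rr v); rewrite (meet_idPr vk).
by apply: Rt (half _ _ exy); apply: Rs; rewrite meetC; exact: half.
Qed.

End ThetaPointless.

Lemma Theta_congruence d (L : frameType d) d' (M : frameType d') (f : L -> M) :
  frame_hom f -> congruence (Theta f).
Proof.
move=> [_ fI fJ]; split; rewrite /Theta //=.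
- by move=> a b c -> ->.
- by move=> a b a' b'; rewrite !fI => -> ->.
- move=> A hA; rewrite !fJ !image_comp; congr fjoin.
  by apply: eq_imagel => q /hA.
Qed.

Lemma congruence_preimage d (L : frameType d) d' (K : frameType d')
    (f : L -> K) (R : set (K * K)) : frame_hom f -> congruence R ->
  congruence [set q : L * L | R (f q.1, f q.2)].
Proof.
move=> [_ fI fJ] [Rr Rs Rt RI RJ]; split=> /=.
- by move=> a; exact: Rr.
- by move=> a b; exact: Rs.
- by move=> a b c; exact: Rt.
- by move=> a b a' b'; rewrite !fI; exact: RI.
- move=> A hA; rewrite !fJ.
  have /RJ : [set (f q.1, f q.2) | q in A] `<=` R by move=> _ [q /hA Rq <-].
  by rewrite !image_comp.
Qed.

(** * Transport along an isomorphism *)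

Lemma max_elements_iso d (L : frameType d) d' (K : frameType d')
    (f : L -> K) (g : K -> L) a : frame_hom f -> frame_hom g ->
  cancel f g -> cancel g f -> max_elements a -> max_elements (f a).
Proof.
move=> hf hg fK gK [a1 h]; split.
  by apply: contra a1 => /eqP e; rewrite -[a]fK e; case: hg => ->.
move=> b b1 ab; rewrite -[b]gK; congr f; apply: h.
  by apply: contra b1 => /eqP e; rewrite -[b]gK e; case: hf => ->.
by rewrite -[a]fK; exact: frame_hom_le.
Qed.

Lemma inverse_hom d (L : frameType d) d' (K : frameType d')
    (f : L -> K) (g : K -> L) :
  frame_hom f -> cancel f g -> cancel g f -> frame_hom g.
Proof.
move=> [f1 fI fJ] fK gK; split=> [|x y|A]; first by rewrite -f1 fK.
  by rewrite -[x in LHS]gK -[y in LHS]gK -fI fK.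
apply: (can_inj fK); rewrite gK fJ image_comp.
by rewrite (_ : f \o g = id) ?image_id //; apply/funext.
Qed.

Section Iso.
Context d (L : frameType d) d' (K : frameType d').
Variables (f : L -> K) (g : K -> L).
Hypotheses (hf : frame_hom f) (fK : cancel f g) (gK : cancel g f).
Let hg : frame_hom g := inverse_hom hf fK gK.

(** A congruence on [K] that contains [Phi] of the relevant maximal elements is
    pulled back along [f] to one on [L], where [Theta_pointless_sub] applies. *)
Lemma class_E_pointless_iso : completely_regular L ->
  class_E (fun y => pointless_map (g y)).
Proof.
move=> hL; have he := frame_hom_comp (pointless_map_hom L) hg.
split; first exact: he.
  by move=> y; have [x <-] := pointless_map_surj y; exists (f x); rewrite fK.
split; first exact: Theta_congruence he.
  move=> _ [a [_ ea] <-] [x y]; rewrite /Phi /Theta /= => exy.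
  case: he => _ eI _; have := congr1 (@pointless_map _ L \o g) exy.
  by rewrite !eI /= ea !meet1x.
move=> R cR hR.
have sub : Theta (@pointless_map _ L) `<=` [set q | R (f q.1, f q.2)].
  apply: (Theta_pointless_sub hL (congruence_preimage hf cR)) => a am.
  move=> [u v]; rewrite /Phi /= => euv.
  apply: (hR (Phi (f a))).
    exists (f a) => //=; split; first exact: (max_elements_iso hf hg).
    by rewrite fK; exact: pointless_map_max.
  by case: hf => _ fI _; rewrite /Phi /= -!fI euv.
move=> [x y] exy; rewrite -[x]gK -[y]gK.
exact: (sub (g x, g y) exy).
Qed.

Lemma class_M_spatial_iso : class_M (fun y => spatial_map (g y)).
Proof.
have gm a : max_elements a -> max_elements (spatial_map (g a)).
  by move=> am; apply: spatial_map_max; exact: (max_elements_iso hg hf).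
split; last by move=> a /gm; exact: max_lt1.
split; first exact: frame_hom_comp (spatial_map_hom L) hg.
by move=> a /gm; exact: pointless_map_max.
Qed.

End Iso.

(** * The subdirect decomposition *)

Lemma pointless_spatial_map_hom d (L : frameType d) :
  frame_hom (@pointless_spatial_map d L).
Proof.
have [p1 pI pJ] := pointless_map_hom L; have [s1 sI sJ] := spatial_map_hom L.
rewrite /pointless_spatial_map; split=> [|x y|A].
- by rewrite p1 s1.
- by rewrite pI sI.
- by rewrite pJ sJ; congr pair; rewrite image_comp.
Qed.

Theorem theorem5p2p2 (d : Order.disp_t) (L : frameType d)
    (hL : completely_regular L) :
  (exists K : subframe (pointless_part L *p spatial_part L),
     subdirect_EM K /\
     exists phi : L -> subframe_type K,
       [/\ frame_hom phi, bijective phi &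
           forall b, val (phi b) = pointless_spatial_map b]) /\
  (exists tau : L -> subframe_type (ligature_product L),
     [/\ frame_hom tau,
         forall b, val (tau b) = pointless_spatial_map b &
         injective tau]).
Proof.
have hps := pointless_spatial_map_hom L.
pose K := image_subframe hps; pose phi : L -> subframe_type K := to_image hps.
(* The inverse of [phi], by [pointless_meet_spatial]. *)
pose psi (y : subframe_type K) : L := val (val y).1 `&` val (val y).2.
have phiK : cancel phi psi by move=> b; exact: pointless_meet_spatial.
have phi_surj : surj phi by exact: to_image_surj.
have psiK : cancel psi phi by move=> y; have [b <-] := phi_surj y; rewrite phiK.
have phi_hom : frame_hom phi by exact: to_image_hom.
have valE y : val y = pointless_spatial_map (psi y) by rewrite -{1}[y]psiK.
have Kcr := completely_regular_surj phi_hom phi_surj hL.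
have fstE : (fun y : subframe_type K => (val y).1)
    = (fun y => pointless_map (psi y)) by apply/funext => y; rewrite valE.
have sndE : (fun y : subframe_type K => (val y).2)
    = (fun y => spatial_map (psi y)) by apply/funext => y; rewrite valE.
split.
  exists K; split; last by exists phi; split=> //; exists psi.
  split=> //.
  - exact: completely_regular_surj (pointless_map_hom L) (@pointless_map_surj _ L) hL.
  - exact: completely_regular_surj (spatial_map_hom L) (@spatial_map_surj _ L) hL.
  - by rewrite fstE; exact: class_E_pointless_iso phi_hom phiK psiK hL.
  - rewrite sndE; split; first exact: class_M_spatial_iso phi_hom phiK psiK.
    move=> y; have [b <-] := spatial_map_surj y.
    by exists (phi b); rewrite phiK.
have mem b : sf_set (ligature_product L) (pointless_spatial_map b).
  apply: (@largest_cr_max _ _ _ K Kcr); last by exists b.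
  by move=> _ [x _ <-]; exact: ligatureE.
exists (fun b => sf_mk (mem b)); split=> //; first exact: subframe_lift.
move=> x y /(congr1 val) /= exy; apply: (can_inj phiK).
exact: val_inj.
Qed.
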